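(* Consider the problem $\min_{x\in\mathcal H}F(x)=f(x)+\psi(x)$ described in the context. Let $x^*$ be an isolated local minimum of $F$ and let $R>0$ be such that $$F(x)\ge F(x^* ),\qquad \operatorname{dist}(x,S)=\|x-x^*\|\qquad\text{for all }x\in B_R(x^* ).$$ Suppose that for some $L\ge0$ and $\mu>0$: (1) $\|f'(y)-f'(x)-H(x)(y-x)\|_*\le L\|x-y\|$ for all $x,y\in B_R(x^* )$, and the subproblem assumption (see context) holds with this $L$; (2) the local PL condition $\frac1{2\mu}\operatorname{dist}(0,\partial F(x))^2\ge F(x)-F(x^* )$ holds for all $x\in B_R(x^* )$; (3) $H(x)\succeq\mu I$ for all $x\in B_R(x^* )$; (4) the quadratic growth condition $\frac\mu2\operatorname{dist}(x,S)^2\le F(x)-F(x^* )$ holds for all $x\in B_R(x^* )$. Let $(x_k)_{k\in\mathbb N}$ be the iterates of the LeAP-SSN algorithm (see context) with starting point $x_0\in\operatorname{dom}F$. Then there exists $\Delta>0$ such that for any $x_0\in B_R(x^* )$ with $\|F'(x_0)\|_*\le\Delta$, $x_k$ converges to $x^*$ linearly and $F(x_k)$ converges to $F(x^* )$ linearly. If in addition $\lambda_k\to0$ as $k\to\infty$, the convergence (of both) is superlinear.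
   Context: Setting. $\mathcal H$ is a real Hilbert space with norm $\|\cdot\|$, dual $\mathcal H^*$ with norm $\|\cdot\|_*$, duality pairing $\langle\cdot,\cdot\rangle$, and Riesz map $\mathcal R:\mathcal H\to\mathcal H^*$. $f\in C^{1,1}(\mathcal H;\mathbb R)$ (Fréchet differentiable with Lipschitz derivative $f'$, possibly nonconvex); $\psi:\mathcal H\to\mathbb R\cup\{+\infty\}$ is proper, convex, lower semicontinuous; $F=f+\psi$ is bounded below with minimal value $F^*$ and the solution set $S=\{x:F(x)=F^*\}$ is nonempty. $\operatorname{dom}F=\{F<+\infty\}$; $\partial\psi$ is the convex subdifferential and $\partial F(x)=f'(x)+\partial\psi(x)$; $\operatorname{dist}(0,\partial F(x))=\inf\{\|g\|_*:g\in\partial F(x)\}$ ($+\infty$ if $\partial F(x)=\emptyset$); $\operatorname{dist}(x,S)=\inf_{u\in S}\|x-u\|$; $B_R(x)$ is the closed ball. To every $x\in\mathcal H$ is associated a symmetric bounded linear operator $H(x):\mathcal H\to\mathcal H^*$; $H(x)\succeq\mu I$ means $\langle H(x)d,d\rangle\ge\mu\|d\|^2$ for all $d\in\mathcal H$. Subproblem. For $x\in\operatorname{dom}F$ and $\lambda\ge0$ let $\widetilde F(y;x,\lambda)=f(x)+\langle f'(x),y-x\rangle+\frac12\langle H(x)(y-x),y-x\rangle+\frac\lambda2\|y-x\|^2+\psi(y)$. A point $x_+=x_+(\lambda,x)$ is an admissible solution if (FO) $-f'(x)-H(x)(x_+-x)-\lambda\mathcal R(x_+-x)\in\partial\psi(x_+)$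 and (D) $\widetilde F(x_+;x,\lambda)\le\widetilde F(x;x,\lambda)=F(x)$. For such a point set $\psi'(x_+)=-f'(x)-H(x)(x_+-x)-\lambda\mathcal R(x_+-x)$ and $F'(x_+)=f'(x_+)+\psi'(x_+)\in\partial F(x_+)$. Subproblem assumption (with constant $L$): for all $\lambda\ge L$ and all $x\in\operatorname{dom}F$ an admissible solution exists (and can be computed). LeAP-SSN algorithm. Input: $m\ge1$, $\alpha\in(0,1/2]$, $\beta\in(0,(m-1)/(2m)]$, $x_0\in\operatorname{dom}F$, $\psi'(x_0)\in\partial\psi(x_0)$, $\Lambda_0>0$; $F'(x_0)=f'(x_0)+\psi'(x_0)$. At iteration $k=0,1,\dots$: for $j=0,1,\dots$, set $\lambda=2^j\Lambda_k$; take an admissible solution $x_+=x_+(\lambda,x_k)$ (if none exists, go to the next $j$); if $$\langle F'(x_+),x_k-x_+\rangle\ge\tfrac\alpha\lambda\|F'(x_+)\|_*^2\quad\text{and}\quad F(x_k)-F(x_+)\ge\beta\lambda\|x_+-x_k\|^2,$$ accept: set $j_k=j$, $x_{k+1}=x_+$, $\lambda_k=\lambda=2^{j_k}\Lambda_k$, $\Lambda_{k+1}=\lambda_k/2$, $F'(x_{k+1})=F'(x_+)$ and go to iteration $k+1$; otherwise go to the next $j$. A nonnegative sequence $(a_k)$ converges to $0$ linearly if $a_k\le Cq^k$ for all $k$ with some $C>0$, $q\in(0,1)$, and superlinearly if $a_{k+1}\le\varepsilon_ka_k$ for all large $k$ with some $\varepsilon_k\to0$; applied to $a_k=\|x_k-x^*\|$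 and $a_k=F(x_k)-F(x^* )$. *)

(* Defs.v *)
From HB Require Import structures.
From mathcomp Require Import all_boot all_order all_algebra.
From mathcomp Require Import all_classical all_reals all_analysis.
Set Implicit Arguments.
Unset Strict Implicit.
Unset Printing Implicit Defensive.
Import Order.TTheory GRing.Theory Num.Theory.
Import numFieldNormedType.Exports.
Local Open Scope classical_set_scope.
Local Open Scope ring_scope.

(** A real Hilbert space is a complete normed module [E] over [R] together with
    an inner product [ip : {dot E for idfun}] that induces the norm of [E].

    A functional is a plain function [E -> R], so that sums and differences of
    functionals are the pointwise ones; [dual] is the set of continuous linear
    functionals, and the pairing of [g] with [d] is the application [g d]. *)
Section Functionals.
Context {R : realType} {E : completeNormedModType R}.

Definition induces_norm (ip : {dot E for idfun}) : Prop :=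
  forall x : E, ip x x = `|x| ^+ 2.

Definition riesz (ip : {dot E for idfun}) (x : E) : E -> R := fun y => ip x y.

Definition dual : set (E -> R) := [set g | linear g /\ continuous g].

Definition dual_norm (g : E -> R) : R :=
  sup [set `|g d| | d in [set d : E | `|d| <= 1]].

Definition symmetric_bounded_operator (A : E -> E -> R) : Prop :=
  [/\ linear A, forall d, dual (A d),
      exists C : R, forall d, dual_norm (A d) <= C * `|d|
    & forall d e, A d e = A e d].

Definition dist_set (x : E) (A : set E) : R := inf [set `|x - u| | u in A].

End Functionals.

Section ConvexAnalysis.
Context {R : realType} {E : completeNormedModType R}.
Local Open Scope ereal_scope.

Definition proper_fun (psi : E -> \bar R) : Prop :=
  (forall x, -oo < psi x) /\ exists x, psi x < +oo.

Definition convex_efun (psi : E -> \bar R) : Prop :=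
  forall (x y : E) (t : R), (0 <= t <= 1)%R ->
    psi (t *: x + (1 - t) *: y)%R <= t%:E * psi x + (1 - t)%:E * psi y.

(** Empty when [psi x = +oo] and [psi] is proper. *)
Definition subdiff (psi : E -> \bar R) (x : E) : set (E -> R) :=
  [set p | dual p /\ forall y, psi x + (p (y - x)%R)%:E <= psi y].

(** The finiteness requirement excludes the interior points of [G = +oo]. *)
Definition local_min (G : E -> \bar R) (x : E) : Prop :=
  G x < +oo /\ \forall y \near x, G x <= G y.

Definition isolated_local_min (G : E -> \bar R) (x : E) : Prop :=
  local_min G x /\ \forall y \near x, local_min G y -> y = x.

End ConvexAnalysis.

Section Problem.
Context {R : realType} {E : completeNormedModType R}.
Variables (f : E -> R) (psi : E -> \bar R).

Definition fderiv (x : E) : E -> R := 'd f x.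

Definition C11 : Prop :=
  (forall x, differentiable f x) /\
  exists M : R, forall x y, dual_norm (fderiv y - fderiv x) <= M * `|y - x|.

Definition obj (x : E) : \bar R := ((f x)%:E + psi x)%E.

Definition edom : set E := [set x | (obj x < +oo)%E].

Definition min_value : \bar R := ereal_inf (range obj).

Definition solutions : set E := [set x | obj x = min_value].

Definition subdiff_obj (x : E) : set (E -> R) :=
  [set fderiv x + p | p in subdiff psi x].

(** Equal to [+oo] when the subdifferential is empty. *)
Definition dist0_subdiff (x : E) : \bar R :=
  ereal_inf [set (dual_norm g)%:E | g in subdiff_obj x].

End Problem.

Section Algorithm.
Context {R : realType} {E : completeNormedModType R}.
Variables (ip : {dot E for idfun}) (f : E -> R) (psi : E -> \bar R).
Variable (H : E -> E -> E -> R).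

Definition model (lam : R) (x y : E) : \bar R :=
  ((f x + fderiv f x (y - x) + 2^-1 * H x (y - x) (y - x)
    + lam / 2 * `|y - x| ^+ 2)%:E + psi y)%E.

Definition psi' (lam : R) (x xp : E) : E -> R :=
  - fderiv f x - H x (xp - x) - lam *: riesz ip (xp - x).

Definition admissible (lam : R) (x xp : E) : Prop :=
  subdiff psi xp (psi' lam x xp) /\ (model lam x xp <= model lam x x)%E.

Definition subproblem_assumption (L : R) : Prop :=
  forall lam x, L <= lam -> edom f psi x -> exists xp, admissible lam x xp.

Definition F' (lam : R) (x xp : E) : E -> R := fderiv f xp + psi' lam x xp.

Definition accepted (alpha beta lam : R) (x xp : E) : Prop :=
  alpha / lam * dual_norm (F' lam x xp) ^+ 2 <= F' lam x xp (x - xp) /\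
  ((beta * lam * `|xp - x| ^+ 2)%:E <= obj f psi x - obj f psi xp)%E.

(** The admissible solution tried for a given [lam] is an arbitrary one, so the
    iterates are described by a relation; [j k] is the index at which the inner
    loop of iteration [k] stops. *)
Record leap_ssn (alpha beta Lam0 : R) (x0 : E)
    (x : nat -> E) (lam Lam : nat -> R) (j : nat -> nat) : Prop := {
  leap_x0 : x 0%N = x0 ;
  leap_Lam0 : Lam 0%N = Lam0 ;
  leap_reject : forall k i, (i < j k)%N ->
    (forall xp, ~ admissible (2 ^+ i * Lam k) (x k) xp) \/
    (exists xp, admissible (2 ^+ i * Lam k) (x k) xp /\
                ~ accepted alpha beta (2 ^+ i * Lam k) (x k) xp) ;
  leap_lam : forall k, lam k = 2 ^+ j k * Lam k ;
  leap_admissible : forall k, admissible (lam k) (x k) (x k.+1) ;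
  leap_accept : forall k, accepted alpha beta (lam k) (x k) (x k.+1) ;
  leap_Lam : forall k, Lam k.+1 = lam k / 2
}.

End Algorithm.

(** The sequences are extended-real valued so that they apply to values of the
    objective; being a nonnegative sequence includes being finite. *)
Section Rates.
Context {R : realType}.
Local Open Scope ereal_scope.

Definition nonneg_seq (a : nat -> \bar R) : Prop := forall k, 0 <= a k < +oo.

Definition cvg0_linearly (a : nat -> \bar R) : Prop :=
  nonneg_seq a /\
  exists C q : R, [/\ (0 < C)%R, (0 < q < 1)%R &
                      forall k, a k <= (C * q ^+ k)%:E].

Definition cvg0_superlinearly (a : nat -> \bar R) : Prop :=
  nonneg_seq a /\
  exists2 eps : nat -> R, eps @ \oo --> (0 : R)%R &
    \forall k \near \oo, a k.+1 <= (eps k)%:E * a k.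

End Rates.

(* Main.v *)
Require Import Defs.
From HB Require Import structures.
From mathcomp Require Import all_boot all_order all_algebra.
From mathcomp Require Import all_classical all_reals all_analysis.
From mathcomp Require Import ring lra.
Set Implicit Arguments.
Unset Strict Implicit.
Unset Printing Implicit Defensive.
Import Order.TTheory GRing.Theory Num.Theory.
Import numFieldNormedType.Exports.
Local Open Scope classical_set_scope.
Local Open Scope ring_scope.

(** The argument tracks the gap [F (x k) - F xs] and compares it with the step
    length [d k = `|x k.+1 - x k|].

    Rate.  An accepted step satisfies [`|F'(x k.+1)| <= (lam k / alpha) * d k]
    ([accepted_residual]), so the PL inequality bounds the new gap by a multiple
    of [(lam k * d k) ^+ 2], while the second acceptance test bounds
    [lam k * d k ^+ 2] by the decrease of the gap.  Hence the new gap is at most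
    a multiple of [lam k] times the decrease: as soon as [lam] is bounded the gap
    decays geometrically, and quadratic growth transfers the rate to
    [`|x k - xs|].  Since also [d k <= C * `|x k - xs|], both ratios of
    consecutive terms are controlled by powers of [lam k], which is the
    superlinear statement.

    Boundedness of [lam].  In the ball the Hessian model is monotone and makes an
    error at most [L] times the step, so every admissible point passes both
    tests once [lam] exceeds a fixed threshold ([large_lam_accepted]); since each
    rejection only doubles [lam], it stays below the larger of its initial value
    and twice the threshold ([line_search_bound]).

    Confinement.  Fermat's rule at the local minimum ([fermat_rule]) and
    monotonicity of the subdifferential show that every admissible point obeys
    [(mu + lam) * `|xp - xs| <= (L + lam) * `|x - xs|] ([step_stable]).  A single
    step may thus expand the distance, but by at most the factor
    [kappa = 1 + L / mu].  Iterates at distance [rho / kappa] therefore produce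
    trial points in the ball, where growth and the monotone decrease of the
    objective force the accepted one back to distance [rho / kappa].  The PL
    inequality turns the smallness of [F'(x0)] into the smallness of the first
    gap that starts this induction. *)

(** * Continuous functionals and the dual norm *)

Section DualNorm.
Context {R : realType} {E : completeNormedModType R}.
Implicit Types (g h : E -> R) (x y d : E) (c : R).

Lemma dual_comb g h c : dual g -> dual h -> dual (c *: g + h).
Proof.
move=> [lg cg] [lh ch]; split=> [a u v|x].
  have E1 : forall z, (c *: g + h) z = c * g z + h z by [].
  rewrite !E1 lg lh /GRing.scale /=; ring.
apply: continuousD; last exact: ch.
by apply: continuousM; [exact: cst_continuous|exact: cg].
Qed.

Lemma dualD g h : dual g -> dual h -> dual (g + h).
Proof. by move=> dg dh; rewrite -[g]scale1r; exact: dual_comb. Qed.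

Lemma dualB g h : dual g -> dual h -> dual (g - h).
Proof. by move=> dg dh; rewrite addrC -scaleN1r; exact: dual_comb. Qed.

Lemma dual_bounded g : dual g -> exists2 c, 0 < c & forall d, `|g d| <= c * `|d|.
Proof.
case=> lg cg.
pose G := GRing.isLinear.Build R E R^o _ g lg.
pose l : {linear E -> R^o} := HB.pack g G.
have /linear_boundedP := @continuous_linear_bounded _ _ _ 0 l (cg 0).
case=> M [Mr /(_ (Num.max M 0 + 1)) B].
exists (Num.max M 0 + 1); first by rewrite ltr_wpDl // le_max lexx orbT.
by apply: B; rewrite ltr_pwDr // le_max lexx.
Qed.

Lemma dual0 g : dual g -> g 0 = 0.
Proof. by case/dual_bounded=> c _ /(_ 0); rewrite normr0 mulr0 normr_le0 => /eqP. Qed.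

Lemma dualZE g c x : dual g -> g (c *: x) = c * g x.
Proof. by move=> dg; have := dg.1 c x 0; rewrite !addr0 (dual0 dg) addr0. Qed.

(** A supremum in [R] is only meaningful for a bounded set, which is what
    continuity of [g] provides; the bound on the unit ball then extends by
    homogeneity. *)
Lemma dual_norm_ub g d : dual g -> `|g d| <= dual_norm g * `|d|.
Proof.
move=> dg; have [->|d0] := eqVneq d 0; first by rewrite (dual0 dg) !normr0 mulr0.
have nd : 0 < `|d| by rewrite normr_gt0.
rewrite -ler_pdivrMr // mulrC -[X in X * _]gtr0_norm ?invr_gt0 // -normrM.
rewrite -dualZE //; apply: ub_le_sup; last first.
  by exists (`|d|^-1 *: d) => //=; rewrite normrZ normfV normr_id mulVf ?gt_eqF.
have [c c0 B] := dual_bounded dg; exists c => _ [e /= e1 <-].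
by rewrite (le_trans (B e)) // ger_pMr.
Qed.

Lemma dual_norm_le g c : 0 <= c -> (forall d, `|g d| <= c * `|d|) -> dual_norm g <= c.
Proof.
move=> c0 B; apply: ge_sup => [|_ [e /= e1 <-]].
  by exists `|g 0|; exists 0 => //=; rewrite normr0.
by rewrite (le_trans (B e)) // ler_piMr.
Qed.

Lemma dual_norm_ge0 g : dual g -> 0 <= dual_norm g.
Proof.
move=> dg; apply: ub_le_sup; last by exists 0; rewrite /= ?normr0 // dual0 // normr0.
have [c c0 B] := dual_bounded dg; exists c => _ [e /= e1 <-].
by rewrite (le_trans (B e)) // ger_pMr.
Qed.

End DualNorm.

(** * The inner product and the Riesz map *)

Section InnerProduct.
Context {R : realType} {E : completeNormedModType R}.
Variables (ip : {dot E for idfun}) (ip_norm : induces_norm ip).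
Implicit Types (x y z : E).

Lemma riesz_linear x : linear (riesz ip x).
Proof. by move=> a u v; rewrite /riesz linearPr. Qed.

Lemma ip_sym x y : ip x y = ip y x.
Proof. by rewrite hermC expr0 mul1r. Qed.

Lemma ipD x y z : ip (x + y) z = ip x z + ip y z.
Proof. exact: linearDl. Qed.

(** Cauchy-Schwarz, obtained by expanding the square of
    [`|y| *: x - `|x| *: y], which is nonnegative. *)
Lemma ip_le_norm x y : ip x y <= `|x| * `|y|.
Proof.
have [->|x0] := eqVneq x 0; first by rewrite linear0l normr0 mul0r.
have [->|y0] := eqVneq y 0; first by rewrite linear0r normr0 mulr0.
have xy : 0 < `|x| * `|y| by rewrite mulr_gt0 ?normr_gt0.
have : 0 <= ip (`|y| *: x - `|x| *: y) (`|y| *: x - `|x| *: y).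
  by rewrite ip_norm exprn_ge0.
rewrite linearBl !linearBr !linearZl_LR !linearZr_LR /= (ip_sym y x) !ip_norm.
move=> h; rewrite -subr_ge0 -(pmulr_rge0 _ xy); move: h; rewrite /GRing.scale /=; lra.
Qed.

Lemma abs_ip_le x y : `|ip x y| <= `|x| * `|y|.
Proof.
rewrite ler_norml ip_le_norm andbT lerNl -linearNl -(normrN x); exact: ip_le_norm.
Qed.

Lemma dual_riesz x : dual (riesz ip x).
Proof.
split; first exact: riesz_linear.
pose G := GRing.isLinear.Build R E R^o _ _ (riesz_linear x).
pose l : {linear E -> R^o} := HB.pack (riesz ip x) G.
apply: (linear_bounded_continuous l).1; apply/linear_boundedP.
exists `|x|; split=> // r xr z; apply: (le_trans (abs_ip_le _ _)).
by rewrite ler_wpM2r // ltW.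
Qed.

End InnerProduct.

(** * Smooth functions *)

Section Smooth.
Context {R : realType} {E : completeNormedModType R}.
Variables (f : E -> R) (f_C11 : C11 f).

Lemma dual_fderiv x : dual (fderiv f x).
Proof.
split; first exact: linearP.
by apply: (@diff_continuous _ _ _ (nbhs_filter_on x)); exact: f_C11.1.
Qed.

Lemma is_derive_line x v (t : R) :
  is_derive t 1 (fun s : R => f (x + s *: v)) (fderiv f (x + t *: v) v).
Proof.
have h : is_diff t (fun s : R => x + s *: v) (fun s => s *: v).
  by apply: is_diff_eq; rewrite add0r.
have d : differentiable f (x + t *: v) by exact: f_C11.1.
have hc : differentiable (f \o (fun s : R => x + s *: v)) t by exact: differentiable_comp.
apply: DeriveDef; first exact/diff_derivable.
by rewrite deriveE // diff_comp //= diff_val /= scale1r.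
Qed.

(** First-order Taylor bound: by the mean value theorem the increment of [f] is
    the derivative at an intermediate point, which differs from the one at [x] by
    at most [M * `|v|].  The factor 1/2 of the integral form is given up. *)
Lemma descent_bound : exists2 M : R, 0 <= M &
  forall x v, `|f (x + v) - f x - fderiv f x v| <= M * `|v| ^+ 2.
Proof.
have [M Mlip] := f_C11.2; exists `|M| => // x v.
have cont : {within `[0, 1], continuous (fun s : R => f (x + s *: v))}.
  apply: continuous_subspaceT => t; apply: differentiable_continuous.
  exact/derivable1_diffP/(@ex_derive _ _ _ _ _ _ _ (is_derive_line x v t)).
have [c] := MVT ltr01 (fun t _ => is_derive_line x v t) cont.
rewrite in_itv /= => /andP[c0 c1]; rewrite scale1r scale0r addr0 subr0 mulr1 => ->.
have /(dual_norm_ub v) := dualB (dual_fderiv (x + c *: v)) (dual_fderiv x).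
move=> /le_trans; apply; rewrite expr2 mulrA ler_wpM2r //.
apply: (le_trans (Mlip _ _)); rewrite addrC addKr normrZ mulrA ler_wpM2r //.
by rewrite (le_trans (ler_norm _)) // normrM normr_id (gtr0_norm c0) ler_piMr // ltW.
Qed.

End Smooth.

(** * Convex subdifferential *)

Section Subdifferential.
Context {R : realType} {E : completeNormedModType R}.
Variables (psi : E -> \bar R) (psi_proper : proper_fun psi).
Implicit Types (x y : E) (p q : E -> R).

Lemma subdiff_fin x p : subdiff psi x p -> psi x \is a fin_num.
Proof.
case=> _ px; rewrite fin_numE gt_eqF ?psi_proper.1 //=.
have [z zfin] := psi_proper.2; apply/eqP => xoo.
by have := px z; rewrite xoo addye // leye_eq lt_eqF.
Qed.

Lemma subdiff_le x y p : subdiff psi x p -> psi y \is a fin_num ->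
  fine (psi x) + p (y - x) <= fine (psi y).
Proof.
move=> px yfin; have xfin := subdiff_fin px.
by rewrite -lee_fin EFinD !fineK //; exact: px.2.
Qed.

Lemma subdiff_monotone x y p q : subdiff psi x p -> subdiff psi y q ->
  q (x - y) <= p (x - y).
Proof.
move=> px qy; have := subdiff_le px (subdiff_fin qy).
have := subdiff_le qy (subdiff_fin px).
rewrite -(opprB x y) -[- (x - y)]scaleN1r (dualZE _ _ px.1); lra.
Qed.

(** For [t] small, minimality on the segment from [x] to [y], convexity of [psi]
    and the Taylor bound for [f] give
    [0 <= t * (psi y - psi x + f' x (y - x)) + M * (t * `|y - x|) ^+ 2].
    Dividing by [t] and letting [t] go to 0 gives the subgradient inequality. *)
Lemma fermat_rule (f : E -> R) x : C11 f -> convex_efun psi ->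
  local_min (obj f psi) x -> subdiff psi x (- fderiv f x).
Proof.
move=> f_C11 psi_convex [objx minx].
have dx := dual_fderiv f_C11 x.
have xfin : psi x \is a fin_num.
  rewrite fin_numE gt_eqF ?psi_proper.1 //=; apply/eqP => xoo.
  by move: objx; rewrite /obj xoo addey.
split.
  by rewrite -[- _]addr0 -scaleN1r -(subrr (fderiv f x)); exact/dual_comb/dualB.
move=> y; have [->|yoo] := eqVneq (psi y) +oo%E; first by rewrite leey.
have yfin : psi y \is a fin_num by rewrite fin_numE gt_eqF ?psi_proper.1.
rewrite -(fineK xfin) -(fineK yfin) -EFinD lee_fin leNgt; apply/negP => ylt.
set a := fine (psi x) in ylt; set b := fine (psi y) in ylt.
set v := y - x in ylt; set s := a + (- fderiv f x) v - b.
have s0 : 0 < s by rewrite subr_gt0.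
have [M M0 fM] := descent_bound f_C11.
have [e /= e0 ball_min] := (nbhs_ballP _ _).1 minx.
(* If the inequality failed by [s], a [t] with [t * (M * `|v| ^+ 2) < s] would
   contradict minimality at [x + t *: v]. *)
have small c k : 0 <= c -> 0 < k -> \forall t \near (0 : R)^'+, t * c < k.
  move=> c0 k0; have c1 : 0 < c + 1 by rewrite ltr_wpDl.
  near=> t; have t0 : 0 < t by near: t; exact: nbhs_right_gt.
  apply: (@le_lt_trans _ _ (t * (c + 1))); first by rewrite ler_wpM2l ?lerDl // ltW.
  by rewrite -ltr_pdivlMr //; near: t; apply: nbhs_right_lt; rewrite divr_gt0.
have [t [t0 t1 te ts]] : exists t : R,
    [/\ 0 < t, t < 1, t * `|v| < e & t * (M * `|v| ^+ 2) < s].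
  near (0 : R)^'+ => t; exists t; split; near: t.
  - exact: nbhs_right_gt.
  - exact: nbhs_right_lt.
  - exact: small.
  - by apply: small => //; rewrite mulr_ge0 // exprn_ge0.
have zx : x + t *: v = t *: y + (1 - t) *: x.
  by rewrite /v scalerBr scalerBl scale1r addrCA addrA.
have zmin : (obj f psi x <= obj f psi (x + t *: v)%R)%E.
  apply: ball_min; rewrite -ball_normE /= opprD addNKr normrN normrZ gtr0_norm //.
have zle : (psi (x + t *: v)%R <= (t * b + (1 - t) * a)%:E)%E.
  rewrite zx EFinD !EFinM !fineK //; apply: psi_convex.
  by rewrite !ltW.
have : ((f x + a)%:E <= (f (x + t *: v)%R + (t * b + (1 - t) * a))%:E)%E.
  by rewrite EFinD [leRHS]EFinD fineK //; apply: (le_trans zmin); rewrite leeD2l.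
rewrite lee_fin => le1.
have := fM x (t *: v); rewrite (dualZE _ _ dx) normrZ (gtr0_norm t0).
move=> /ler_normlP[_ le2].
have E1 : (- fderiv f x) v = - fderiv f x v by [].
have : t * s <= t * (t * (M * `|v| ^+ 2)) by rewrite /s E1; lra.
by rewrite ler_pM2l // leNgt ts.
Unshelve. all: by end_near. Qed.

End Subdifferential.

(** * A single regularized Newton step *)

Section Step.
Context {R : realType} {E : completeNormedModType R}.
Context {ip : {dot E for idfun}} (ip_norm : induces_norm ip).
Context {f : E -> R} (f_C11 : C11 f) {psi : E -> \bar R} (psi_proper : proper_fun psi).
Context {H : E -> E -> E -> R} (H_op : forall x, symmetric_bounded_operator (H x)).
Implicit Types (x xp d e : E) (lam mu L : R).

Lemma operatorD x d e : H x (d + e) = H x d + H x e.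
Proof. by case: (H_op x) => lH _ _ _; rewrite -[d]scale1r lH !scale1r. Qed.

Lemma dual_residual x xp : dual (fderiv f xp - fderiv f x - H x (xp - x)).
Proof.
case: (H_op x) => _ dH _ _.
by apply: dualB; [apply: dualB; exact: dual_fderiv|exact: dH].
Qed.

Lemma dual_F' lam x xp : subdiff psi xp (psi' ip f H lam x xp) ->
  dual (F' ip f H lam x xp).
Proof. by case=> dp _; apply: dualD => //; exact: dual_fderiv. Qed.

Lemma psi'E lam x xp d : psi' ip f H lam x xp d =
  - fderiv f x d - H x (xp - x) d - lam * ip (xp - x) d.
Proof. by []. Qed.

Lemma F'E lam x xp d : F' ip f H lam x xp d =
  (fderiv f xp - fderiv f x - H x (xp - x)) d - lam * ip (xp - x) d.
Proof.
have -> : F' ip f H lam x xp d = fderiv f xp d + psi' ip f H lam x xp d by [].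
have -> : (fderiv f xp - fderiv f x - H x (xp - x)) d =
  fderiv f xp d - fderiv f x d - H x (xp - x) d by [].
by rewrite psi'E !addrA.
Qed.

(** Test the monotonicity of the subdifferential, between the subgradient
    selected at [xp] and [- f' xs] at [xs], with [e = xp - xs].  Writing
    [xp - x = e + (xs - x)], the parts of [H x] and of the Riesz map along [e]
    give [(mu + lam) * `|e| ^+ 2]; what remains is the linearization error
    between [x] and [xs] and [lam * ip (xs - x) e].  The linearization error at
    [xp] does not enter, so [xp] may be arbitrary. *)
Lemma step_stable lam mu L x xp xs : 0 <= lam -> 0 < mu ->
  subdiff psi xs (- fderiv f xs) ->
  dual_norm (fderiv f xs - fderiv f x - H x (xs - x)) <= L * `|x - xs| ->
  (forall d, mu * `|d| ^+ 2 <= H x d d) ->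
  subdiff psi xp (psi' ip f H lam x xp) ->
  (mu + lam) * `|xp - xs| <= (L + lam) * `|x - xs|.
Proof.
move=> lam0 mu0 opt approx coercive step.
set e := xp - xs; have [->|e0] := eqVneq e 0.
  rewrite normr0 mulr0.
  have := le_trans (dual_norm_ge0 (dual_residual x xs)) approx.
  by rewrite mulrDl => ?; rewrite addr_ge0 // mulr_ge0.
have ne : 0 < `|e| by rewrite normr_gt0.
rewrite -(ler_pM2r ne).
have := subdiff_monotone psi_proper step opt; rewrite -/e.
have := dual_norm_ub e (dual_residual x xs).
have := coercive e; have := abs_ip_le ip_norm (xs - x) e.
have split_step : xp - x = e + (xs - x) by rewrite /e addrA subrK.
rewrite psi'E split_step (operatorD x e (xs - x)).
have -> : (H x e + H x (xs - x)) e = H x e e + H x (xs - x) e by [].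
have -> : (- fderiv f xs) e = - fderiv f xs e by [].
have -> : (fderiv f xs - fderiv f x - H x (xs - x)) e =
  fderiv f xs e - fderiv f x e - H x (xs - x) e by [].
have -> : ip (e + (xs - x)) e = `|e| ^+ 2 + ip (xs - x) e.
  by rewrite ipD ip_norm.
rewrite [`|xs - x|]distrC => /ler_normlP[/(ler_wpM2l lam0) hip _].
move=> hH /ler_normlP[_ hr] mono.
have := ler_wpM2r (ltW ne) approx; lra.
Qed.

Lemma first_order_bound lam L x xp : 0 <= lam ->
  dual_norm (fderiv f xp - fderiv f x - H x (xp - x)) <= L * `|x - xp| ->
  dual_norm (F' ip f H lam x xp) <= (L + lam) * `|xp - x|.
Proof.
rewrite distrC => lam0 approx.
have L0 := le_trans (dual_norm_ge0 (dual_residual x xp)) approx.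
apply: dual_norm_le => [|d].
  by rewrite mulrDl addr_ge0 // mulr_ge0.
rewrite F'E; apply: (le_trans (ler_normB _ _)).
rewrite mulrDl mulrDl lerD //.
  apply: (le_trans (dual_norm_ub _ (dual_residual x xp))).
  by rewrite ler_wpM2r.
rewrite normrM ger0_norm // -mulrA ler_wpM2l //; exact: abs_ip_le.
Qed.

(** With [v = xp - x] one has [F'(xp) = r - lam *: riesz v], where the
    linearization error [r] has norm at most [L * `|v|].  For large [lam] the
    residual is essentially [- lam *: riesz v], so the first test holds with
    ratio close to 1, above [alpha]; it suffices that
    [(L + lam) ^+ 2 <= 2 * lam * (lam - L)], which [5 * L <= lam] ensures.  For
    the second test, the subgradient inequality for [psi] at [xp] and the Taylor
    bound for [f], whose constant is [M / 2], give a decrease of at least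
    [(lam - M / 2) * `|v| ^+ 2], and this exceeds half of [lam * `|v| ^+ 2]. *)
Lemma large_lam_accepted alpha beta : 0 <= alpha <= 2^-1 -> 0 <= beta <= 2^-1 ->
  exists2 M : R, 0 <= M & forall lam L x xp, 0 <= L -> 5 * L + M < lam ->
    psi x \is a fin_num ->
    dual_norm (fderiv f xp - fderiv f x - H x (xp - x)) <= L * `|x - xp| ->
    (forall d, 0 <= H x d d) ->
    subdiff psi xp (psi' ip f H lam x xp) ->
    accepted ip f psi H alpha beta lam x xp.
Proof.
move=> /andP[alpha0 alpha1] /andP[beta0 beta1].
have [M M0 fM] := descent_bound f_C11.
exists (2 * M) => [|lam L x xp L0 lam_large xfin approx Hge0 step].
  by rewrite mulr_ge0.
have lam0 : 0 < lam by rewrite (le_lt_trans _ lam_large) // addr_ge0 // mulr_ge0.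
have xpfin := subdiff_fin psi_proper step.
set v := xp - x.
have dv : x - xp = - 1 *: v by rewrite scaleN1r opprB.
have v0 : 0 <= `|v| by [].
split.
  rewrite dv (dualZE _ _ (dual_F' step)).
  rewrite F'E -/v ip_norm.
  have := dual_norm_ub v (dual_residual x xp); rewrite -/v.
  have := first_order_bound (ltW lam0) approx; rewrite -/v => Nle.
  move: approx; rewrite distrC -/v => approx /ler_normlP[_ hr].
  have {}hr := le_trans hr (ler_wpM2r v0 approx).
  have N0 := dual_norm_ge0 (dual_F' step).
  apply: (@le_trans _ _ ((lam - L) * `|v| ^+ 2)); last by lra.
  have N2 : dual_norm (F' ip f H lam x xp) ^+ 2 <= (L + lam) ^+ 2 * `|v| ^+ 2.
    by rewrite -exprMn lerXn2r // nnegrE // mulr_ge0 // addr_ge0 // ltW.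
  rewrite mulrAC ler_pdivrMr //.
  apply: (@le_trans _ _ (2^-1 * ((L + lam) ^+ 2 * `|v| ^+ 2))).
    by apply: ler_pM => //; rewrite exprn_ge0.
  rewrite mulrA (mulrAC _ _ lam) ler_wpM2r ?exprn_ge0 //.
  nra.
rewrite /obj -(fineK xfin) -(fineK xpfin) -!EFinD lee_fin -/v.
have := subdiff_le psi_proper step xfin.
rewrite dv (dualZE _ _ step.1).
rewrite psi'E -/v ip_norm.
have xv : x + v = xp by rewrite addrC subrK.
have := fM x v; rewrite xv => /ler_normlP[_ hf].
have := Hge0 v.
have : beta * lam * `|v| ^+ 2 <= (lam - M) * `|v| ^+ 2.
  rewrite ler_wpM2r ?exprn_ge0 //.
  by have := ler_wpM2r (ltW lam0) beta1; lra.
move: (fine _) (fine _) => a b; lra.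
Qed.

(** The first test bounds [alpha / lam * N ^+ 2] by a pairing that is at most
    [N * `|xp - x|], for [N] the norm of the residual; cancel one [N]. *)
Lemma accepted_residual alpha beta lam x xp : 0 < alpha -> 0 < lam ->
  subdiff psi xp (psi' ip f H lam x xp) ->
  accepted ip f psi H alpha beta lam x xp ->
  dual_norm (F' ip f H lam x xp) <= lam / alpha * `|xp - x|.
Proof.
move=> alpha0 lam0 step [acc _].
have dF := dual_F' step; have N0 := dual_norm_ge0 dF.
set N := dual_norm _ in acc N0 *.
have {}acc : alpha / lam * N ^+ 2 <= N * `|xp - x|.
  by rewrite distrC (le_trans acc) // (le_trans (ler_norm _)) // dual_norm_ub.
have [Np|] := ltrP 0 N; last first.
  by move=> /le_trans; apply; rewrite mulr_ge0 // divr_ge0 // ltW.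
rewrite -invf_div mulrC ler_pdivlMr ?divr_gt0 //.
by rewrite -(ler_pM2l Np); move: acc; rewrite expr2 mulrCA (mulrC N (_ / _)).
Qed.

End Step.

(** * Line search *)

Section LineSearch.
Context {R : realType} {E : completeNormedModType R}.
Context {ip : {dot E for idfun}} {f : E -> R} {psi : E -> \bar R} {H : E -> E -> E -> R}.
Context {alpha beta Lam0 : R} {x0 : E} {x : nat -> E}.
Context {lam Lam : nat -> R} {j : nat -> nat}.
Context (run : leap_ssn ip f psi H alpha beta Lam0 x0 x lam Lam j).

(** If the search stops after at least one rejection, the last rejected value,
    which is [lam k / 2], cannot exceed [T]. *)
Lemma line_search_bound L T k : subproblem_assumption ip f psi H L -> L <= T ->
  edom f psi (x k) ->
  (forall l xp, T < l -> admissible ip f psi H l (x k) xp ->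
     accepted ip f psi H alpha beta l (x k) xp) ->
  0 < Lam k -> 0 < lam k /\ lam k <= Num.max (Lam k) (2 * T).
Proof.
move=> sub LT xdom acc Lamk0; rewrite (leap_lam run k); split.
  by rewrite mulr_gt0 // exprn_gt0.
case jk: (j k) => [|i]; first by rewrite expr0 mul1r le_max lexx.
rewrite le_max exprS -mulrA ler_pM2l //; apply/orP; right.
rewrite leNgt; apply/negP => Tl.
have ij : (i < j k)%N by rewrite jk.
have [none|[xp [adm]]] := leap_reject run ij.
- have [xp adm] := sub _ _ (le_trans LT (ltW Tl)) xdom; exact: none adm.
- by apply; exact: acc.
Qed.

End LineSearch.

(** * From residual to objective gap *)

Section PolyakLojasiewicz.
Context {R : realType} {E : completeNormedModType R}.
Context {f : E -> R} (f_C11 : C11 f) {psi : E -> \bar R}.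

Lemma gap_le_residual (mu : R) (gap : R) (x : E) (p : E -> R) : 0 < mu ->
  (gap%:E <= ((2 * mu)^-1)%:E * dist0_subdiff f psi x ^+ 2)%E ->
  subdiff psi x p -> gap <= (2 * mu)^-1 * dual_norm (fderiv f x + p) ^+ 2.
Proof.
move=> mu0 PL px; rewrite -lee_fin; apply: (le_trans PL).
rewrite EFinM lee_pmul2l ?lte_fin ?invr_gt0 ?mulr_gt0 //.
have d0 : (0 <= dist0_subdiff f psi x)%E.
  apply: le_ereal_inf_tmp => _ [_ [q [dq _] <-] <-]; rewrite lee_fin.
  by apply: dual_norm_ge0; apply: dualD => //; exact: dual_fderiv.
have dN : (dist0_subdiff f psi x <= (dual_norm (fderiv f x + p))%:E)%E.
  by apply: ereal_inf_lbound; exists (fderiv f x + p) => //; exists p.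
by rewrite expe2 expr2 EFinM lee_pmul.
Qed.

End PolyakLojasiewicz.

(** * Convergence rates of real sequences *)

Section Rates.
Context {R : realType}.
Implicit Types a b : nat -> R.

(** The hypothesis reads [(c + 1) * a k.+1 <= c * a k].  The larger ratio
    [(c + 1) / (c + 2)] is used because [c / (c + 1)] vanishes for [c = 0],
    whereas the ratio must be positive; likewise [a 0 + 1] keeps the
    multiplicative constant positive. *)
Lemma cvg0_linearly_gap a (c : R) : 0 <= c -> (forall k, 0 <= a k) ->
  (forall k, a k.+1 <= c * (a k - a k.+1)) -> cvg0_linearly (fun k => (a k)%:E).
Proof.
move=> c0 a0 step; split=> [k|]; first by rewrite lee_fin a0 ltry.
have c1 : 0 < c + 1 by rewrite ltr_wpDl.
have c2 : 0 < c + 2 by rewrite ltr_wpDl.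
have q0 : 0 <= (c + 1) / (c + 2) by rewrite divr_ge0 // ltW.
exists (a 0%N + 1), ((c + 1) / (c + 2)); split.
- by rewrite ltr_wpDl.
- by rewrite divr_gt0 //= ltr_pdivrMr // mul1r ltrD2l ltr1n.
elim=> [|k IH]; first by rewrite lee_fin expr0 mulr1 lerDl.
rewrite lee_fin in IH *; rewrite exprS mulrCA.
apply: le_trans (ler_wpM2l q0 IH).
rewrite mulrAC ler_pdivlMr //; have := step k; have := a0 k; have := a0 k.+1.
move: (a k) (a k.+1) => u v; nra.
Qed.

Lemma cvg0_linearly_sqrt a b (K : R) : 0 < K -> (forall k, 0 <= b k) ->
  (forall k, b k ^+ 2 <= K * a k) ->
  cvg0_linearly (fun k => (a k)%:E) -> cvg0_linearly (fun k => (b k)%:E).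
Proof.
move=> K0 b0 ba [_ [C [q [C0 /andP[q0 q1] aC]]]].
split=> [k|]; first by rewrite lee_fin b0 ltry.
exists (Num.sqrt (K * C)), (Num.sqrt q); split.
- by rewrite sqrtr_gt0 mulr_gt0.
- by rewrite sqrtr_gt0 q0 /= -sqrtr1 ltr_sqrt.
move=> k; rewrite lee_fin -(ger0_norm (b0 k)) -sqrtr_sqr.
have -> : Num.sqrt q ^+ k = Num.sqrt (q ^+ k).
  elim: k => [|k IH]; first by rewrite !expr0 sqrtr1.
  by rewrite !exprS sqrtrM ?IH // ltW.
rewrite -sqrtrM; last by rewrite mulr_ge0 // ltW.
apply: ler_wsqrtr.
by rewrite (le_trans (ba k)) // -mulrA ler_pM2l // -lee_fin.
Qed.

Lemma cvg0_superlinearly_EFin a (eps : nat -> R) : (forall k, 0 <= a k) ->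
  eps @ \oo --> (0 : R) -> (forall k, a k.+1 <= eps k * a k) ->
  cvg0_superlinearly (fun k => (a k)%:E).
Proof.
move=> a0 eps0 step; split=> [k|]; first by rewrite lee_fin a0 ltry.
by exists eps => //; apply: nearW => k; rewrite -EFinM lee_fin.
Qed.

End Rates.

(** * Local convergence *)

Theorem theorem5p1 (R : realType) (E : completeNormedModType R)
  (ip : {dot E for idfun}) (ip_norm : induces_norm ip)
  (f : E -> R) (f_C11 : C11 f)
  (psi : E -> \bar R) (psi_proper : proper_fun psi)
  (psi_convex : convex_efun psi) (psi_lsc : lower_semicontinuous psi)
  (F_bounded : exists c : R, forall x, (c%:E <= obj f psi x)%E)
  (S_nonempty : solutions f psi !=set0)
  (H : E -> E -> E -> R) (H_op : forall x, symmetric_bounded_operator (H x))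
  (m alpha beta Lam0 : R) (m_ge1 : 1 <= m) (alpha_range : 0 < alpha <= 2^-1)
  (beta_range : 0 < beta <= (m - 1) / (2 * m)) (Lam0_gt0 : 0 < Lam0)
  (xs : E) (xs_min : isolated_local_min (obj f psi) xs)
  (rho : R) (rho_gt0 : 0 < rho)
  (xs_ball : forall x, closed_ball xs rho x ->
     (obj f psi xs <= obj f psi x)%E /\
     dist_set x (solutions f psi) = `|x - xs|)
  (L mu : R) (L_ge0 : 0 <= L) (mu_gt0 : 0 < mu)
  (H_approx : forall x y, closed_ball xs rho x -> closed_ball xs rho y ->
     dual_norm (fderiv f y - fderiv f x - H x (y - x)) <= L * `|x - y|)
  (subproblem : subproblem_assumption ip f psi H L)
  (local_PL : forall x, closed_ball xs rho x ->
     (((2 * mu)^-1)%:E * dist0_subdiff f psi x ^+ 2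
        >= obj f psi x - obj f psi xs)%E)
  (H_coercive : forall x, closed_ball xs rho x ->
     forall d, H x d d >= mu * `|d| ^+ 2)
  (quadratic_growth : forall x, closed_ball xs rho x ->
     ((mu / 2 * dist_set x (solutions f psi) ^+ 2)%:E
        <= obj f psi x - obj f psi xs)%E) :
  exists2 Delta : R, 0 < Delta &
    forall (x0 : E) (psi'0 : E -> R)
      (x : nat -> E) (lam Lam : nat -> R) (j : nat -> nat),
      edom f psi x0 ->
      subdiff psi x0 psi'0 ->
      leap_ssn ip f psi H alpha beta Lam0 x0 x lam Lam j ->
      closed_ball xs rho x0 ->
      dual_norm (fderiv f x0 + psi'0) <= Delta ->
      [/\ cvg0_linearly (fun k => (`|x k - xs|)%:E),
          cvg0_linearly (fun k => obj f psi (x k) - obj f psi xs)%E &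
          lam @ \oo --> (0 : R) ->
            cvg0_superlinearly (fun k => (`|x k - xs|)%:E) /\
            cvg0_superlinearly (fun k => obj f psi (x k) - obj f psi xs)%E].
Proof.
move: alpha_range beta_range => /andP[alpha0 alpha1] /andP[beta0 beta1].
have beta_half : beta <= 2^-1.
  by rewrite (le_trans beta1) // ler_pdivrMr; lra.
have opt := fermat_rule psi_proper f_C11 psi_convex xs_min.1.
have xsfin := subdiff_fin psi_proper opt.
have ballE y : closed_ball xs rho y <-> `|y - xs| <= rho.
  by rewrite closed_ballE // /closed_ball_ /= distrC.
have xs_in : closed_ball xs rho xs by apply/ballE; rewrite subrr normr0 ltW.
pose val y := f y + fine (psi y); pose gap y := val y - val xs.
have objE y : psi y \is a fin_num -> obj f psi y = (val y)%:E.
  by move=> yfin; rewrite /obj /val EFinD fineK.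
have gapE y : psi y \is a fin_num -> (obj f psi y - obj f psi xs)%E = (gap y)%:E.
  by move=> yfin; rewrite !objE.
have growth y : closed_ball xs rho y -> psi y \is a fin_num ->
    `|y - xs| ^+ 2 <= 2 / mu * gap y.
  move=> yin yfin; have := quadratic_growth _ yin.
  rewrite gapE // (xs_ball _ yin).2 lee_fin.
  by rewrite -ler_pdivlMl ?divr_gt0 // invf_div.
have gap_ge0 y : closed_ball xs rho y -> psi y \is a fin_num -> 0 <= gap y.
  move=> yin yfin; have := le_trans (exprn_ge0 2 (normr_ge0 _)) (growth y yin yfin).
  by rewrite pmulr_rge0 // divr_gt0.
have PL y p : closed_ball xs rho y -> subdiff psi y p ->
    gap y <= (2 * mu)^-1 * dual_norm (fderiv f y + p) ^+ 2.
  move=> yin yp; apply: (gap_le_residual f_C11 mu_gt0 _ yp).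
  by rewrite -gapE ?local_PL //; exact: subdiff_fin yp.
pose kappa := 1 + L / mu.
have kappa1 : 1 <= kappa by rewrite lerDl divr_ge0 // ltW.
have kappa0 : 0 < kappa by rewrite (lt_le_trans ltr01).
have stable l y yp : 0 <= l -> closed_ball xs rho y ->
    admissible ip f psi H l y yp -> `|yp - xs| <= kappa * `|y - xs|.
  move=> l0 yin [step _].
  have := step_stable ip_norm f_C11 psi_proper H_op l0 mu_gt0 opt
    (H_approx _ _ yin xs_in) (H_coercive _ yin) step.
  rewrite -ler_pdivlMl ?ltr_wpDr // => /le_trans; apply.
  rewrite mulrA ler_wpM2r // ler_pdivrMl ?ltr_wpDr // /kappa.
  have : 0 <= l * (L / mu) by rewrite mulr_ge0 // divr_ge0 // ltW.
  have : mu * (L / mu) = L by rewrite mulrC divfK // gt_eqF.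
  lra.
pose delta := rho / kappa.
have delta0 : 0 < delta by rewrite divr_gt0.
have delta_in y : `|y - xs| <= delta -> closed_ball xs rho y.
  by move=> yd; apply/ballE/(le_trans yd); rewrite ler_pdivrMr // ler_peMr // ltW.
have stay l y yp : 0 <= l -> `|y - xs| <= delta -> admissible ip f psi H l y yp ->
    closed_ball xs rho yp.
  move=> l0 yd adm; apply/ballE/(le_trans (stable _ _ _ l0 (delta_in _ yd) adm)).
  by rewrite -ler_pdivlMl // mulrC.
have [M M0 large] := large_lam_accepted ip_norm f_C11 psi_proper H_op
  (introT andP (conj (ltW alpha0) alpha1)) (introT andP (conj (ltW beta0) beta_half)).
(* Trial points must lie in the ball for the linearization error at them to be
   controlled, whence the restriction to the smaller ball. *)
have accept_large l y yp : 5 * L + M < l -> psi y \is a fin_num ->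
    `|y - xs| <= delta -> admissible ip f psi H l y yp ->
    accepted ip f psi H alpha beta l y yp.
  move=> ltl yfin yd adm; have yin := delta_in _ yd.
  have l0 : 0 <= l by rewrite (le_trans _ (ltW ltl)) // addr_ge0 // mulr_ge0.
  apply: (large l L) => // [|d|]; last exact: adm.1.
    by apply: H_approx => //; exact: stay adm.
  by apply: le_trans (H_coercive _ yin d); rewrite mulr_ge0 ?exprn_ge0 // ltW.
(* The PL inequality bounds the initial gap by [mu / 2 * delta ^+ 2], and this is
   the gap below which quadratic growth confines a point to distance [delta]. *)
exists (mu * delta); first by rewrite mulr_gt0.
move=> x0 psi'0 x lam Lam j x0dom x0sub run x0in F'0.
pose Lmax := Num.max Lam0 (2 * (5 * L + M)).
have LT : L <= 5 * L + M by lra.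
pose inv k := [/\ closed_ball xs rho (x k), psi (x k) \is a fin_num,
  gap (x k) <= mu / 2 * delta ^+ 2, 0 < Lam k & Lam k <= Lmax].
have near_xs k : inv k -> `|x k - xs| <= delta.
  case=> xin xfin xgap _ _.
  rewrite -(@ler_pXn2r _ 2) ?nnegrE ?(ltW delta0) //.
  by rewrite (le_trans (growth _ xin xfin)) // -ler_pdivlMl ?divr_gt0 // invf_div.
have step k : inv k -> [/\ inv k.+1, 0 < lam k, lam k <= Lmax &
    beta * lam k * `|x k.+1 - x k| ^+ 2 <= gap (x k) - gap (x k.+1)].
  move=> invk; have xd := near_xs k invk; case: invk => xin xfin xgap Lam_gt0 Lam_le.
  have adm := leap_admissible run k.
  have [lam0 lam_le] : 0 < lam k /\ lam k <= Num.max (Lam k) (2 * (5 * L + M)).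
    apply: (line_search_bound run subproblem LT) => //.
    - by rewrite /edom /= objE // ltry.
    - by move=> l xp ltl; exact: accept_large.
  have lam_max : lam k <= Lmax.
    by rewrite (le_trans lam_le) // ge_max Lam_le le_max lexx orbT.
  have yfin := subdiff_fin psi_proper adm.1.
  have yin := stay _ _ _ (ltW lam0) xd adm.
  have [_] := leap_accept run k; rewrite !objE // lee_fin => decrease.
  have gap_decrease : beta * lam k * `|x k.+1 - x k| ^+ 2 <= gap (x k) - gap (x k.+1).
    by rewrite /gap opprB addrA subrK.
  have : 0 <= beta * lam k * `|x k.+1 - x k| ^+ 2.
    by rewrite mulr_ge0 ?exprn_ge0 // mulr_ge0 // ltW.
  split=> //; split=> //; rewrite ?(leap_Lam run); lra.
have inv_all k : inv k.
  elim: k => [|k /step[]//].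
  rewrite /inv (leap_x0 run) (leap_Lam0 run); split=> //.
  - exact: subdiff_fin x0sub.
  - apply: (le_trans (PL _ _ x0in x0sub)).
    have N0 : 0 <= dual_norm (fderiv f x0 + psi'0).
      by apply/dual_norm_ge0/dualD; [exact: dual_fderiv|exact: x0sub.1].
    have N2 : dual_norm (fderiv f x0 + psi'0) ^+ 2 <= (mu * delta) ^+ 2.
      by rewrite lerXn2r // nnegrE mulr_ge0 // ltW.
    rewrite ler_pdivrMl ?mulr_gt0 // (le_trans N2) //; lra.
  - by rewrite le_max lexx.
pose a k := gap (x k); pose b k := `|x k - xs|.
have aE : (fun k => obj f psi (x k) - obj f psi xs)%E = (fun k => (a k)%:E).
  by apply/funext => k; have [_ xfin _ _ _] := inv_all k; rewrite gapE.
have a0 k : 0 <= a k by have [xin xfin _ _ _] := inv_all k; exact: gap_ge0.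
have b0 k : 0 <= b k := normr_ge0 _.
have ba k : b k ^+ 2 <= 2 / mu * a k.
  by have [xin xfin _ _ _] := inv_all k; exact: growth.
have lam0 k : 0 < lam k by have [] := step k (inv_all k).
have lam_max k : lam k <= Lmax by have [] := step k (inv_all k).
have gap_next k : a k.+1 <= (lam k / alpha) ^+ 2 / (2 * mu) * `|x k.+1 - x k| ^+ 2.
  have [xin _ _ _ _] := inv_all k.+1.
  have adm := (leap_admissible run k).1.
  apply: (le_trans (PL _ _ xin adm)).
  have N := accepted_residual f_C11 alpha0 (lam0 k) adm (leap_accept run k).
  rewrite mulrAC mulrC ler_pM2r ?invr_gt0 ?mulr_gt0 // -exprMn lerXn2r // nnegrE.
    by apply: dual_norm_ge0; exact: (dual_F' f_C11 adm).
  by rewrite mulr_ge0 // divr_ge0 // ltW.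
have a_lin : cvg0_linearly (fun k => (a k)%:E).
  apply: (@cvg0_linearly_gap _ _ (Lmax / (2 * mu * alpha ^+ 2 * beta))) => // [|k].
    by rewrite divr_ge0 ?mulr_ge0 ?exprn_ge0 // ?(le_trans _ (lam_max 0%N)) // ltW.
  have [_ _ _ decrease] := step k (inv_all k).
  apply: (le_trans (gap_next k)).
  have -> : (lam k / alpha) ^+ 2 / (2 * mu) * `|x k.+1 - x k| ^+ 2 =
      lam k / (2 * mu * alpha ^+ 2 * beta) * (beta * lam k * `|x k.+1 - x k| ^+ 2).
    by field; rewrite !gt_eqF.
  apply: ler_pM => //.
  - by rewrite divr_ge0 ?mulr_ge0 ?exprn_ge0 // ltW.
  - by rewrite ?mulr_ge0 ?exprn_ge0 // ltW.
  - by rewrite ler_pM2r // invr_gt0 !mulr_gt0 // exprn_gt0.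
rewrite aE; split=> //.
  by apply: (cvg0_linearly_sqrt _ b0 ba a_lin); rewrite divr_gt0.
move=> lam_cvg.
pose eps k := (1 + kappa) / (alpha * mu) * lam k.
have eps_cvg : eps @ \oo --> (0 : R).
  by rewrite -[0](mulr0 ((1 + kappa) / (alpha * mu))); exact: cvgMr.
have eps0 k : 0 <= eps k.
  by apply/ltW/mulr_gt0 => //; apply: divr_gt0; [exact: addr_gt0|exact: mulr_gt0].
have displacement k : `|x k.+1 - x k| <= (1 + kappa) * b k.
  have xd := near_xs k (inv_all k); have xin := delta_in _ xd.
  rewrite (le_trans (ler_distD xs _ _)) // mulrDl mul1r addrC [`|xs - _|]distrC lerD2l.
  exact: stable (ltW (lam0 k)) xin (leap_admissible run k).
have a_eps k : a k.+1 <= mu / 2 * eps k ^+ 2 * b k ^+ 2.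
  apply: (le_trans (gap_next k)).
  have -> : mu / 2 * eps k ^+ 2 * b k ^+ 2 =
      (lam k / alpha) ^+ 2 / (2 * mu) * ((1 + kappa) * b k) ^+ 2.
    by rewrite /eps; field; rewrite !gt_eqF.
  apply: ler_wpM2l; first by rewrite divr_ge0 ?sqr_ge0 // mulr_ge0 // ltW.
  rewrite lerXn2r ?nnegrE ?displacement //.
  by apply/mulr_ge0 => //; exact/ltW/addr_gt0.
(* Growth at [x k.+1] turns [a_eps] into a ratio of distances, growth at [x k]
   into a ratio of gaps; its factor [2 / mu] cancels [mu / 2]. *)
split.
  apply: (cvg0_superlinearly_EFin b0 eps_cvg) => k.
  rewrite -(@ler_pXn2r _ 2) ?nnegrE ?(mulr_ge0 (eps0 k) (b0 k)) //.
  apply: (le_trans (ba _)).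
  by rewrite -ler_pdivlMl ?divr_gt0 // invf_div exprMn mulrA.
apply: (@cvg0_superlinearly_EFin _ _ (fun k => eps k * eps k)) => // [|k].
  by rewrite -[0](mulr0 0); exact: cvgM.
apply: (le_trans (a_eps k)).
rewrite -expr2 mulrAC mulrC ler_wpM2l ?exprn_ge0 //.
by rewrite -ler_pdivlMl ?divr_gt0 // invf_div.
Qed.
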